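(* Let $p\ge 1$, let $F=f+\psi$ be as in the context, with $p$th derivative of $f$ Lipschitz continuous with constant $L_p$, and let $D<+\infty$. Let the inner accuracies $\{\delta_k\}_{k\ge1}$ be chosen according to the rule $$\delta_k := c\cdot\bigl(F(x_{k-2})-F(x_{k-1})\bigr),\qquad k\ge 2,$$ for some fixed $0\le c<\frac{1}{(p+2)3^{p+1}-1}$, and $\delta_1\ge 0$. Then for the sequence $\{x_k\}_{k\ge1}$ produced by Monotone Inexact Tensor Method II (described in the context) we have, for all $k\ge1$, $$F(x_k)-F^*\;\le\;\frac{\gamma L_pD^{p+1}}{p!\,k^p}+\frac{\beta}{k^{p+2}},$$ where $$\gamma=\frac{(p+2)^{p+1}}{1-c\left((p+2)3^{p+1}-1\right)},\qquad \beta=\frac{\delta_1+c\,2^{p+2}(F(x_0)-F^* )}{1-c\left(\frac{(p+2)^2}{p+1}-1\right)}.$$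
   Context: Setting. $\mathbb{E}$ is a finite-dimensional real vector space with dual $\mathbb{E}^*$, and $\langle s,x\rangle$ is the value of $s\in\mathbb{E}^*$ at $x\in\mathbb{E}$. $B:\mathbb{E}\to\mathbb{E}^*$ is a fixed symmetric positive definite linear operator and $\|x\|=\langle Bx,x\rangle^{1/2}$. For a $p$-linear symmetric form, $\|D^pf(x)\|=\max_{\|h_i\|\le 1}D^pf(x)[h_1,\dots,h_p]$; $D^kf(x)[h]^k$ denotes the $k$th directional derivative along $h$ taken $k$ times. Problem: minimize $F(x)=f(x)+\psi(x)$ over $x\in\mathbb{E}$, where $\psi:\mathbb{E}\to\mathbb{R}\cup\{+\infty\}$ is proper closed convex and $f:\operatorname{dom}\psi\to\mathbb{R}$ is convex and (sufficiently many times, at least $p$ times) differentiable. A solution $x^*\in\operatorname{dom}\psi$ is assumed to exist and is fixed; $F^*=F(x^* )$. Lipschitz assumption: $\|D^pf(x)-D^pf(y)\|\le L_p\|x-y\|$ for all $x,y\in\operatorname{dom}\psi$. Model: for $H\ge 0$, $$\Omega_H(x;y)=f(x)+\sum_{k=1}^p\frac1{k!}D^kf(x)[y-x]^k+\frac{H\|y-x\|^{p+1}}{(p+1)!}+\psi(y).$$ Inexact monotone $\delta$-step: $M_{H,\delta}(x)$ denotes any point $M\in\operatorname{dom}\psi$ satisfying both $\Omega_H(x;M)-\min_y\Omega_H(x;y)\le\delta$ and $F(M)<F(x)$. Monotone Inexact Tensor Method II: choose $x_0\in\operatorname{dom}\psi$, fix $H:=pL_p$. For $k=0,1,2,\dots$: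 given $\delta_{k+1}\ge0$, compute $x_{k+1}:=M_{H,\delta_{k+1}}(x_k)$. Radius of the initial level set: $D=\sup_x\{\|x-x^*\| : F(x)\le F(x_0)\}$. *)

(* Defs.v *)
From HB Require Import structures.
From mathcomp Require Import all_boot all_order all_algebra all_fingroup.
From mathcomp Require Import all_classical all_reals all_analysis.

Set Implicit Arguments.
Unset Strict Implicit.
Unset Printing Implicit Defensive.

Import Order.TTheory GRing.Theory Num.Theory.
Import numFieldNormedType.Exports.

Local Open Scope classical_set_scope.
Local Open Scope ring_scope.

Section MultilinearForms.
Context {R : realType} (E : vectType R).

Definition dual_space : vectType R := 'Hom(E, R^o).

(* k-linear forms in curried form: [mform 0] is R and [mform 1] is the dual. *)
Fixpoint mform (k : nat) : vectType R :=
  if k is k'.+1 then 'Hom(E, mform k') else R^o.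

End MultilinearForms.

Section Forms.
Context {R : realType} {E : vectType R}.

(* meval A h is A[h_1, ..., h_k]. *)
Fixpoint meval (k : nat) : mform E k -> k.-tuple E -> R :=
  match k return mform E k -> k.-tuple E -> R with
  | 0 => fun A _ => A
  | k'.+1 => fun A h =>
      meval ((A : 'Hom(E, mform E k')) (thead h)) [tuple of behead h]
  end.

Definition mdiag (k : nat) (A : mform E k) (h : E) : R :=
  meval A [tuple of nseq k h].

Definition msymmetric (k : nat) (A : mform E k) : Prop :=
  forall (s : 'S_k) (h : k.-tuple E),
    meval A [tuple tnth h (s i) | i < k] = meval A h.

Definition spd (B : 'Hom(E, dual_space E)) : Prop :=
  (forall x y, (B x : 'Hom(E, R^o)) y = (B y : 'Hom(E, R^o)) x) /\
  (forall x, x != 0 -> 0 < ((B x : 'Hom(E, R^o)) x : R)).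

Definition Bnorm (B : 'Hom(E, dual_space E)) (x : E) : R :=
  Num.sqrt ((B x : 'Hom(E, R^o)) x).

(* Intended for k >= 1: there is no absolute value because a sign can be moved
   into an argument. *)
Definition mnorm (B : 'Hom(E, dual_space E)) (k : nat) (A : mform E k) : \bar R :=
  ereal_sup [set (meval A h)%:E |
             h in [set h : k.-tuple E | forall i, Bnorm B (tnth h i) <= 1]].

(* A is a Frechet derivative at x, relative to S, of the form-valued map G; the
   error G y - G x - A[y - x] is o(|y - x|) uniformly over unit arguments, that
   is, in the norm of k-linear forms. S need not be open. *)
Definition is_derivative_within (B : 'Hom(E, dual_space E)) (S : set E) (k : nat)
    (G : E -> mform E k) (x : E) (A : mform E k.+1) : Prop :=
  forall eps : R, 0 < eps -> exists2 d : R, 0 < d &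
    forall y : E, S y -> Bnorm B (y - x) < d ->
    forall h : k.-tuple E, (forall i, Bnorm B (tnth h i) <= 1) ->
      `|meval (G y - G x - (A : 'Hom(E, mform E k)) (y - x)) h|
        <= eps * Bnorm B (y - x).

(* On S, f is p times differentiable with derivatives D^k f = Df k, k <= p. *)
Record derivatives_on (B : 'Hom(E, dual_space E)) (S : set E) (p : nat)
    (f : E -> R) (Df : forall k, E -> mform E k) : Prop := DerivativesOn {
  derivatives_on0 : forall x, S x -> Df 0%N x = f x ;
  derivatives_onS : forall k x, (k < p)%N -> S x ->
    is_derivative_within B S (Df k) x (Df k.+1 x) ;
  derivatives_on_sym : forall k x, (k <= p)%N -> S x -> msymmetric (Df k x) }.

Definition lipschitz_derivative (B : 'Hom(E, dual_space E)) (S : set E) (p : nat)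
    (Df : forall k, E -> mform E k) (L : R) : Prop :=
  forall x y, S x -> S y ->
    (mnorm B (Df p x - Df p y) <= (L * Bnorm B (x - y))%:E)%E.

End Forms.

Section CompositeProblem.
Context {R : realType} {E : vectType R}.

Definition effective_domain (psi : E -> \bar R) : set E := [set x | (psi x < +oo)%E].

Definition epigraph (psi : E -> \bar R) : set (E * R^o) :=
  [set z | (psi z.1 <= (z.2 : R)%:E)%E].

Definition proper_function (psi : E -> \bar R) : Prop :=
  (forall x, psi x != -oo%E) /\ effective_domain psi !=set0.

Definition convex_epigraph (psi : E -> \bar R) : Prop :=
  convex_set (epigraph psi).

(* Sequential closedness of the epigraph, for the norm of B on E. *)
Definition closed_function (B : 'Hom(E, dual_space E)) (psi : E -> \bar R) :
    Prop :=
  forall (u : nat -> E) (r : nat -> R) (x : E) (t : R),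
    (forall n, epigraph psi (u n, r n)) ->
    (fun n => Bnorm B (u n - x)) @ \oo --> (0 : R) -> r @ \oo --> t ->
    epigraph psi (x, t).

Definition objective (f : E -> R) (psi : E -> \bar R) (x : E) : \bar R :=
  ((f x)%:E + psi x)%E.

Definition is_solution (f : E -> R) (psi : E -> \bar R) (xs : E) : Prop :=
  effective_domain psi xs /\ forall y, (objective f psi xs <= objective f psi y)%E.

(* Omega_H(x; y) *)
Definition model (B : 'Hom(E, dual_space E)) (p : nat) (f : E -> R)
    (Df : forall k, E -> mform E k) (psi : E -> \bar R) (H : R) (x y : E) :
    \bar R :=
  ((f x + \sum_(1 <= k < p.+1) (k`!%:R)^-1 * mdiag (Df k x) (y - x)
    + H * Bnorm B (y - x) ^+ p.+1 / (p.+1)`!%:R)%:E + psi y)%E.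

(* M is an admissible value of M_{H,delta}(x). When the model has a minimizer
   the infimum is its minimum; when the infimum is -oo no M is admissible. *)
Definition inexact_monotone_step (B : 'Hom(E, dual_space E)) (p : nat) (f : E -> R)
    (Df : forall k, E -> mform E k) (psi : E -> \bar R) (H delta : R)
    (x M : E) : Prop :=
  [/\ effective_domain psi M,
      (model B p f Df psi H x M - ereal_inf (range (model B p f Df psi H x))
        <= delta%:E)%E &
      (objective f psi M < objective f psi x)%E].

(* x 0, ..., x n are the iterates of the first n iterations; an infinite run is
   one for which this holds for every n. *)
Definition monotone_inexact_tensor_method_II (B : 'Hom(E, dual_space E)) (p : nat)
    (f : E -> R) (Df : forall k, E -> mform E k) (psi : E -> \bar R) (L : R)
    (delta : nat -> R) (x : nat -> E) (n : nat) : Prop :=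
  effective_domain psi (x 0%N) /\
  forall k, (k < n)%N -> 0 <= delta k.+1 /\
    inexact_monotone_step B p f Df psi (p%:R * L) (delta k.+1) (x k) (x k.+1).

Definition level_radius (B : 'Hom(E, dual_space E)) (f : E -> R)
    (psi : E -> \bar R) (xs x0 : E) : \bar R :=
  ereal_sup [set (Bnorm B (x - xs))%:E |
             x in [set x | (objective f psi x <= objective f psi x0)%E]].

End CompositeProblem.

(* Main.v *)
Require Import Defs.
From mathcomp Require Import all_boot all_order all_algebra all_fingroup.
From mathcomp Require Import all_classical all_reals all_analysis.
From mathcomp Require Import ring lra.

Import Order.TTheory GRing.Theory Num.Theory.
Import numFieldNormedType.Exports.
Local Open Scope classical_set_scope.
Local Open Scope ring_scope.

(* Write d_k = F(x_k) - F^* and C = L D^(p+1) / p!. The Taylor bound, applied at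
   M and at the point x_k + s (x^* - x_k), together with convexity of F gives
     d_(k+1) <= (1 - s) d_k + s^(p+1) C + delta_(k+1)   for every s in [0, 1].
   Since delta_(k+1) = c (d_(k-1) - d_k), the right-hand side is nondecreasing in
   d_k and d_(k-1) whenever s + c <= 1, so the bound U_k = gamma C / k^p +
   beta / k^(p+2) propagates by a two-step induction, without summation. Writing
   r = k / (k + 1) and q = k / (k - 1), the choice
     s = 1 - r^(p+2) + c (q^(p+2) - 1)
   reproduces the beta-term of U_(k+1) exactly, and the gamma-term reduces to
   s^(p+1) <= gamma / (k + 1)^(p+1). The first three iterates use s = 1. *)

(** * Elementary inequalities and the scalar recursion *)

Section Rate.
Variable R : realFieldType.
Implicit Types (c e q r x : R) (k m p : nat).

Lemma bernoulli_ge m x : -1 <= x -> 1 + m%:R * x <= (1 + x) ^+ m.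
Proof.
move=> x1; elim: m => [|m IH]; first by rewrite expr0 mul0r addr0.
rewrite exprS; apply: (le_trans _ (ler_wpM2l _ IH)); last by lra.
have : 0 <= m%:R * x ^+ 2 by rewrite mulr_ge0 ?sqr_ge0 ?ler0n.
rewrite -natr1; nra.
Qed.

(** For e <= 1, Bernoulli at - e gives 1 - m e <= (1 - e)^m, and ((1 + e)(1 - e))^m <= 1. For e > 1
    and m >= 1 the second factor is nonpositive. *)
Lemma one_add_exp_mul_le1 m e : 0 <= e -> (1 + e) ^+ m * (1 - m%:R * e) <= 1.
Proof.
move=> e0; have [e1|e1] := leP e 1; last first.
  case: m => [|m]; first by rewrite expr0 !mul0r; lra.
  apply: (@le_trans _ _ 0); last by lra.
  rewrite mulr_ge0_le0 ?exprn_ge0//; first lra.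
  have : 1 <= m.+1%:R :> R by rewrite ler1n.
  nra.
have := @bernoulli_ge m (- e); rewrite lerN2 => /(_ e1) b.
have p0 : 0 <= (1 + e) ^+ m by rewrite exprn_ge0//; lra.
apply: (@le_trans _ _ ((1 + e) ^+ m * (1 - e) ^+ m)).
  by rewrite ler_wpM2l//; lra.
rewrite -exprMn exprn_ile1//; nra.
Qed.

(** In the factorization by q - 1, each of the m + 1 powers of q in the sum is at most q^m. *)
Lemma expr_sub1_le m q : 1 <= q -> q ^+ m.+1 - 1 <= m.+1%:R * (q - 1) * q ^+ m.
Proof.
move=> q1; rewrite subrX1 -mulrA mulrCA ler_wpM2l ?subr_ge0//.
rewrite mulr_natl -[X in _ *+ X]card_ord -sumr_const.
apply: ler_sum => i _; apply: ler_weXn2l => //.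
by rewrite -ltnS ltn_ord.
Qed.

(** With y = (3/2)^(p+1) and z = 2^(p+1), 3^(p+1) = y z; then z >= 2 and y >= 1 suffice. This
    inequality brings in the denominator of gamma. *)
Lemma exp3_bound p : 2 * (p.+1%:R * (3 / 2) ^+ p.+1) <= p.+2%:R * 3 ^+ p.+1 - 1 :> R.
Proof.
have a : 4 <= 2 ^+ p.+1 * 2 :> R.
  by rewrite exprS; have : 1 <= 2 ^+ p :> R; [rewrite exprn_ege1//; lra|lra].
have b : 1 <= (3 / 2 : R) ^+ p.+1 by rewrite exprn_ege1//; lra.
have -> : 3 ^+ p.+1 = (3 / 2) ^+ p.+1 * 2 ^+ p.+1 :> R.
  by rewrite -exprMn; congr (_ ^+ _); field.
have e1 : p.+1%:R = p%:R + 1 :> R by rewrite natr1.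
have e2 : p.+2%:R = p%:R + 2 :> R by rewrite -addn2 natrD.
rewrite e1 e2; have pp : 0 <= p%:R :> R by [].
set y := (3 / 2) ^+ p.+1 in b *; set z := 2 ^+ p.+1 in a *.
have yz : 2 * y <= y * z by nra.
have p2 : 0 <= p%:R + 2 :> R by lra.
have := ler_wpM2l p2 yz; nra.
Qed.

(** * Propagation of the rate bound from k and k + 1 to k + 2 *)

Section Step.
Variables (p k : nat) (c : R).
Hypotheses (k2 : (2 <= k)%N) (c0 : 0 <= c)
  (cN : c * (p.+2%:R * 3 ^+ p.+1 - 1) < 1).
(** Compared with the overview the index is shifted by one: the current iterate is k + 1, and [a] is
    the weight called s there. The condition k >= 2 gives r >= 3/4 and q <= 3/2. *)
Let r : R := k.+1%:R / k.+2%:R.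
Let q : R := k.+1%:R / k%:R.
Let a : R := 1 - r ^+ p.+2 + c * (q ^+ p.+2 - 1).

Let k2R : 2 <= k%:R :> R. Proof. by rewrite ler_nat. Qed.

Let kS : k.+1%:R = k%:R + 1 :> R. Proof. by rewrite natr1. Qed.
Let kSS : k.+2%:R = k%:R + 2 :> R. Proof. by rewrite -addn2 natrD. Qed.

Let r01 : 3 / 4 <= r <= 1.
Proof.
have := k2R; rewrite /r kS kSS => k2'.
by rewrite ler_pdivlMr ?ler_pdivrMr; lra.
Qed.

Let q1 : 1 <= q <= 3 / 2.
Proof.
have := k2R; rewrite /q kS => k2'.
by rewrite ler_pdivlMr ?ler_pdivrMr; lra.
Qed.

Let a_ge0 : 0 <= a.
Proof.
have [r0 r1] := andP r01; have [q0 _] := andP q1.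
rewrite /a addr_ge0// ?mulr_ge0// subr_ge0 ?exprn_ege1// exprn_ile1//; lra.
Qed.

(** Amounts to c q^(p+2) <= r^(p+2). The worst case is k = 2, where it reads c 2^(p+2) <= 1; this
    follows from [cN] because 2^(p+2) <= (p+2) 3^(p+1) - 1. *)
Let a_le : a + c <= 1.
Proof.
have [r0 r1] := andP r01; have [q0 q2] := andP q1.
have hc : c * q ^+ p.+2 <= r ^+ p.+2.
  apply: (@le_trans _ _ (c * (3 / 2) ^+ p.+2)).
    by rewrite ler_wpM2l// lerXn2r ?nnegrE//; lra.
  apply: (@le_trans _ _ ((3 / 4) ^+ p.+2)); last first.
    by rewrite lerXn2r ?nnegrE//; lra.
  have z0 : 0 < (4 / 3 : R) ^+ p.+2 by rewrite exprn_gt0.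
  rewrite -(ler_pM2r z0) -mulrA -!exprMn.
  have -> : 3 / 2 * (4 / 3) = 2 :> R by field.
  have -> : 3 / 4 * (4 / 3) = 1 :> R by field.
  rewrite expr1n; apply: le_trans (ltW cN); rewrite ler_wpM2l// exprS.
  have -> : 3 ^+ p.+1 = (3 / 2) ^+ p.+1 * 2 ^+ p.+1 :> R.
    by rewrite -exprMn; congr (_ ^+ _); field.
  have y1 : 3 / 2 <= (3 / 2 : R) ^+ p.+1 by rewrite -[leLHS]expr1 ler_weXn2l//; lra.
  have z1 : 1 <= (2 : R) ^+ p.+1 by rewrite exprn_ege1//; lra.
  have p1 : 2 <= p.+2%:R :> R by rewrite ler_nat.
  have yz : 3 / 2 * 2 ^+ p.+1 <= (3 / 2) ^+ p.+1 * 2 ^+ p.+1 :> R.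
    by rewrite ler_wpM2r//; lra.
  have := ler_wpM2r (le_trans (mulr_ge0 _ _) yz) p1; nra.
rewrite /a; lra.
Qed.

(** First a <= (p+2)/(k+2) (1 + e): Bernoulli bounds 1 - r^(p+2), and 1/k <= 2/(k+2) bounds q - 1.
    Then (1 + e)^(p+1) (1 - (p+1) e) <= 1, while [exp3_bound] bounds (p+1) e by c ((p+2) 3^(p+1) -
    1). *)
Let a_pow : a ^+ p.+1 * (1 - c * (p.+2%:R * 3 ^+ p.+1 - 1)) <= (p.+2%:R / k.+2%:R) ^+ p.+1.
Proof.
have [r0 r1] := andP r01; have [q0 q2] := andP q1.
have K0 : 0 < k.+2%:R :> R by [].
pose e : R := 2 * (c * (3 / 2) ^+ p.+1).
have e0 : 0 <= e by rewrite /e !mulr_ge0// exprn_ge0//; lra.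
have h : a <= p.+2%:R / k.+2%:R * (1 + e).
  have h1 : 1 - r ^+ p.+2 <= p.+2%:R / k.+2%:R.
    have rE : r = 1 + - (1 / k.+2%:R).
      by rewrite /r kS kSS; field; have := k2R; lra.
    have /(@bernoulli_ge p.+2) : -1 <= - (1 / k.+2%:R) :> R.
      by rewrite lerN2 ler_pdivrMr// mul1r ler1n.
    by rewrite -rE mulrN mulrA mulr1 lerBlDr -lerBlDl.
  have h2 : q ^+ p.+2 - 1 <= p.+2%:R / k.+2%:R * (2 * (3 / 2) ^+ p.+1).
    apply: (le_trans (expr_sub1_le _ _ q0)).
    rewrite -!mulrA ler_wpM2l// mulrA.
    apply: ler_pM; rewrite ?subr_ge0 ?exprn_ge0 //; try lra.
      have := k2R; rewrite /q kS kSS => k2'.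
      rewrite [leRHS]mulrC ler_pdivlMr; last by lra.
      have -> : (k%:R + 1) / k%:R - 1 = k%:R^-1 :> R by field; lra.
      by rewrite mulrC ler_pdivrMr; lra.
    by rewrite lerXn2r ?nnegrE//; lra.
  rewrite /a [leRHS]mulrDr mulr1 lerD// (le_trans (ler_wpM2l c0 h2))// /e.
  by rewrite le_eqVlt; apply/orP; left; apply/eqP; ring.
have u0 : 0 <= p.+2%:R / k.+2%:R :> R by rewrite divr_ge0.
have N0 : 0 <= 1 - c * (p.+2%:R * 3 ^+ p.+1 - 1) by rewrite subr_ge0 ltW.
apply: (@le_trans _ _ ((p.+2%:R / k.+2%:R) ^+ p.+1 * ((1 + e) ^+ p.+1 * (1 - p.+1%:R * e)))).
  rewrite mulrA -exprMn; apply: ler_pM => //.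
  - by rewrite exprn_ge0.
  - by rewrite lerXn2r ?nnegrE// mulr_ge0//; lra.
  - rewrite lerD2l lerN2 (_ : p.+1%:R * e = c * (2 * (p.+1%:R * (3 / 2) ^+ p.+1))).
      by rewrite ler_wpM2l// exp3_bound.
    by rewrite /e; ring.
by rewrite -[leRHS]mulr1 ler_wpM2l ?exprn_ge0// one_add_exp_mul_le1.
Qed.

(** All powers are expressed over k + 1 through r and q. As 1 - a - c = r^(p+2) - c q^(p+2), the
    b-terms on the left add up exactly to b / (k+2)^(p+2); only the terms with C need an
    estimate. *)
Lemma rate_bound_propagates (C b : R) (u := fun i : nat =>
      p.+2%:R ^+ p.+1 / (1 - c * (p.+2%:R * 3 ^+ p.+1 - 1)) * C / i%:R ^+ p + b / i%:R ^+ p.+2) :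
  0 <= C -> exists2 s, 0 <= s & s + c <= 1 /\
    (1 - s - c) * u k.+1 + s ^+ p.+1 * C + c * u k <= u k.+2.
Proof.
move=> C0; exists a; first exact: a_ge0.
split; first exact: a_le.
have [r0 r1] := andP r01; have [q0 _] := andP q1; have k2' := k2R.
have xz j : (k.+2%:R ^+ j)^-1 = r ^+ j / k.+1%:R ^+ j :> R.
  by rewrite /r expr_div_n mulrAC divff ?mul1r// expf_neq0.
have xy j : (k%:R ^+ j)^-1 = q ^+ j / k.+1%:R ^+ j :> R.
  by rewrite /q expr_div_n mulrAC divff ?mul1r// expf_neq0.
have D0 : 0 < 1 - c * (p.+2%:R * 3 ^+ p.+1 - 1) by rewrite subr_gt0.
rewrite /u; set G := p.+2%:R ^+ p.+1 / _.
have G0 : 0 <= G by rewrite divr_ge0 ?exprn_ge0//; lra.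
(* Since r <= 1, 1 - r^2 >= 1 - r = 1/(k+2), so the right-hand side is at least G / (k+2)^(p+1). *)
have aG : a ^+ p.+1 <= G * (r ^+ p / k.+1%:R ^+ p * (1 - r ^+ 2)).
  apply: (@le_trans _ _ (G * ((k.+2%:R ^+ p)^-1 * k.+2%:R^-1))).
    rewrite -invfM -exprSr /G mulrAC ler_pdivlMr//.
    by apply: le_trans a_pow _; rewrite expr_div_n.
  rewrite -xz !ler_wpM2l ?invr_ge0 ?exprn_ge0//.
  have -> : k.+2%:R^-1 = 1 - r by rewrite /r kS kSS; field; lra.
  nra.
have qq : c * (q ^+ p / k.+1%:R ^+ p * (1 - q ^+ 2)) <= 0.
  rewrite mulr_ge0_le0// mulr_ge0_le0 ?divr_ge0 ?exprn_ge0//; first lra.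
  nra.
rewrite !xz !xy.
have := ler_wpM2r C0 aG; have := ler_wpM2l (mulr_ge0 G0 C0) qq.
have -> : 1 - a - c = r ^+ p.+2 - c * q ^+ p.+2 by rewrite /a; ring.
have e2 t : t ^+ p.+2 = t ^+ p * t ^+ 2 :> R by rewrite -exprD addn2.
rewrite (e2 r) (e2 q) mulr0.
move: (a ^+ p.+1) (r ^+ p) (q ^+ p) (_ ^+ p)^-1 (_ ^+ p.+2)^-1 (G) => A rp qp Y W G'.
lra.
Qed.
End Step.

(** The hypothesis [step] is the one-step estimate with s still free. The choice s = 1 starts the
    induction, and the s of [rate_bound_propagates] continues it. *)
Lemma rate_of_recursion p (c C : R) (d delta : nat -> R) n :
  (0 < p)%N -> 0 <= c -> c * (p.+2%:R * 3 ^+ p.+1 - 1) < 1 -> 0 <= C ->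
  0 <= delta 1%N ->
  (forall k, (k <= n)%N -> 0 <= d k) ->
  (forall k, (k.+2 <= n)%N -> delta k.+2 = c * (d k - d k.+1)) ->
  (forall k s, (k < n)%N -> 0 <= s <= 1 ->
     d k.+1 <= (1 - s) * d k + s ^+ p.+1 * C + delta k.+1) ->
  let g := p.+2%:R ^+ p.+1 / (1 - c * (p.+2%:R * 3 ^+ p.+1 - 1)) in
  let b := (delta 1%N + c * 2 ^+ p.+2 * d 0%N)
           / (1 - c * (p.+2%:R ^+ 2 / p.+1%:R - 1)) in
  forall k, (1 <= k <= n)%N -> d k <= g * C / k%:R ^+ p + b / k%:R ^+ p.+2.
Proof.
move=> p0 c0 cN C0 del1 d0 hdel step.
have p1 : 1 <= p%:R :> R by rewrite ler1n.
have pS : p.+1%:R = p%:R + 1 :> R by rewrite natr1.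
have pSS : p.+2%:R = p%:R + 2 :> R by rewrite -addn2 natrD.
have y1 : 3 <= (3 : R) ^+ p by rewrite -[leLHS]expr1 ler_weXn2l//; lra.
set N := p.+2%:R * 3 ^+ p.+1 - 1 in cN *.
set M := p.+2%:R ^+ 2 / p.+1%:R - 1; move=> g b.
have N3 : 3 ^+ p.+2 <= N + 1.
  rewrite /N subrK [leLHS]exprS ler_wpM2r ?exprn_ge0//; lra.
have N26 : 26 <= N by rewrite /N pSS exprS; nra.
have M1 : 1 <= M by rewrite /M lerBrDl ler_pdivlMr ?pSS ?pS; nra.
have MN : M <= N.
  rewrite /M /N lerD2r ler_pdivrMr// expr2 -mulrA ler_wpM2l// pS pSS exprS; nra.
have cN0 : 0 <= c * N by rewrite mulr_ge0//; lra.
have cM : c * M <= c * N by rewrite ler_wpM2l.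
have cM0 : 0 <= c * M by rewrite mulr_ge0//; lra.
have g1 : p.+2%:R ^+ p.+1 <= g.
  by rewrite /g ler_pdivlMr; [|lra]; rewrite ler_piMr ?exprn_ge0//; lra.
have d00 : 0 <= d 0%N by apply: d0.
have z0 : 0 <= c * 2 ^+ p.+2 * d 0%N by rewrite mulr_ge0// mulr_ge0// exprn_ge0.
(* (1 + c)(1 - c M) <= 1 because M >= 1. The spare factor 1 + c is spent at the third iterate. *)
have b1 : (delta 1%N + c * 2 ^+ p.+2 * d 0%N) * (1 + c) <= b.
  rewrite /b ler_pdivlMr; last by lra.
  rewrite -[leLHS]mulrA ler_piMr ?addr_ge0//; nra.
(* Uses (p+2)^(p+1) >= 2 * 3^p. The factor 2 leaves room for (1 + c) C at the third iterate. *)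
have gi i : 0 < i%:R :> R -> i%:R <= 3 :> R -> 2 * i%:R ^+ p <= g.
  move=> i0 i3; apply: le_trans g1; rewrite exprS.
  apply: ler_pM; rewrite ?exprn_ge0 ?pSS ?ler0n//; first lra.
  by rewrite lerXn2r ?nnegrE//; lra.
have gC i : 0 < i%:R :> R -> i%:R <= 3 :> R -> 2 * C <= g * C / i%:R ^+ p.
  move=> i0 i3; have := ler_wpM2r C0 (gi i i0 i3).
  by rewrite ler_pdivlMr ?exprn_gt0// [_ * C * _]mulrAC.
(* Propagation needs its lower index to be at least 2, so the two-step argument first produces
   iterate 4; iterates 1, 2 and 3 are treated directly. *)
elim/ltn_ind => -[|[|[|[|k]]]] IH // /andP[_ kn].
- have := step 0%N 1 kn; rewrite ler01 lexx expr1n => /(_ isT) d1.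
  have := gC 1%N; rewrite !expr1n !divr1 => gC1.
  have := gC1 ltr01; rewrite ler1n => /(_ isT); nra.
- have := step 1%N 1 kn; rewrite ler01 lexx expr1n hdel// => /(_ isT) d2.
  have gC2 : 2 * C <= g * C / 2 ^+ p by apply: gC; lra.
  (* Here d_2 <= C + c d_0, which accounts for the term c 2^(p+2) d_0 in beta. *)
  have b2 : c * d 0%N <= b / 2 ^+ p.+2.
    rewrite ler_pdivlMr ?exprn_gt0// mulrAC; apply: le_trans b1; nra.
  have := d0 1%N (ltnW kn); nra.
- have := step 2%N 1 kn; rewrite ler01 lexx expr1n hdel// => /(_ isT) d3.
  have := step 0%N 1 (ltnW (ltnW kn)); rewrite ler01 lexx expr1n => /(_ isT) d1.
  have gC3 : 2 * C <= g * C / 3 ^+ p by apply: gC; lra.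
  (* Here d_3 <= C + c d_1 <= (1 + c) C + c delta_1, and c 3^(p+2) <= c (N + 1) <= 1 + c. *)
  have b3 : c * delta 1%N <= b / 3 ^+ p.+2.
    rewrite ler_pdivlMr ?exprn_gt0// mulrAC; apply: le_trans b1.
    rewrite [leRHS]mulrC; apply: ler_pM => //; first by rewrite mulr_ge0 ?exprn_ge0.
    - by have := ler_wpM2l c0 N3; lra.
    - by rewrite lerDl.
  have := d0 2%N (ltnW kn); nra.
have k4 : (2 <= k.+2)%N by [].
have [s s0 [sc]] := rate_bound_propagates _ _ _ k4 c0 cN _ b C0.
apply: le_trans.
have ds : d k.+4 <= (1 - s - c) * d k.+3 + s ^+ p.+1 * C + c * d k.+2.
  have s1 : 0 <= s <= 1 by apply/andP; split => //; lra.
  have := step k.+3 s kn s1; rewrite hdel//; lra.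
apply: (le_trans ds); rewrite lerD//.
  rewrite lerD2r; apply: ler_wpM2l; first by lra.
  by apply: IH => //; rewrite (ltnW kn).
by apply: ler_wpM2l => //; apply: IH => //; rewrite (ltnW (ltnW kn)).
Qed.
End Rate.

(** * Taylor remainder on [0, 1] under a Lipschitz bound on the last derivative *)

Section Taylor.
Variable R : realType.

Definition taylor_poly (p : nat) (a : nat -> R) : {poly R} :=
  \poly_(k < p) (a k / k`!%:R).

Lemma deriv_taylor_poly p a :
  (taylor_poly p.+1 a)^`() = taylor_poly p (fun k => a k.+1).
Proof.
apply/polyP => k; rewrite coef_deriv !coef_poly ltnS.
case: ifP => _; last by rewrite mul0rn.
rewrite -[LHS]mulr_natr factS natrM -mulrA; congr (_ * _).
by rewrite invfM mulrAC mulVf ?mul1r// pnatr_eq0.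
Qed.

Lemma taylor_poly0 p a : (taylor_poly p.+1 a).[0] = a 0%N.
Proof. by rewrite horner_coef0 coef_poly /= fact0 divr1. Qed.

(** Induction on p: the shifted family bounds the derivative, and the mean value theorem integrates
    the bound. The function [phi p] itself is never differentiated. *)
Lemma taylor_lipschitz_le (p : nat) (phi : nat -> R -> R) (K : R) :
  (forall k (t : R), (k < p)%N -> t \in `]0, 1[ -> is_derive t 1 (phi k) (phi k.+1 t)) ->
  (forall k, (k < p)%N -> {within `[0, 1], continuous (phi k)}) ->
  (forall t : R, t \in `[0, 1] -> phi p t - phi p 0 <= K * t) ->
  forall t : R, t \in `[0, 1] ->
    phi 0%N t - (taylor_poly p.+1 (phi ^~ 0)).[t] <= K * t ^+ p.+1 / (p.+1)`!%:R.
Proof.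
elim: p phi => [|p IH] phi hd hc hK t t01.
  by rewrite horner_poly big_ord1 factS !fact0 !divr1 expr0 mulr1 expr1; exact: hK.
have {}IH (u : R) : u \in `[0, 1] ->
    phi 1%N u - (taylor_poly p.+1 (fun k => phi k.+1 0)).[u]
      <= K * u ^+ p.+1 / (p.+1)`!%:R.
  by apply: (IH (fun k => phi k.+1)) => *; [exact: hd|exact: hc|exact: hK].
(* P includes the claimed remainder term, so the goal is g t <= 0; g vanishes at 0 and the induction
   hypothesis makes its derivative nonpositive. *)
pose P := taylor_poly p.+2 (phi ^~ 0) + (K / (p.+2)`!%:R) *: 'X^(p.+2).
pose g s := phi 0%N s - P.[s].
have [t0 t1] : 0 <= t /\ t <= 1 by move: t01; rewrite in_itv /= => /andP.
have P0 : P.[0] = phi 0%N 0.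
  by rewrite /P hornerD taylor_poly0 hornerZ hornerXn expr0n mulr0 addr0.
have gd (s : R) : s \in `]0, t[ -> is_derive s 1 g (phi 1%N s - P^`().[s]).
  move=> s0t; apply: is_deriveB; apply: hd => //.
  by move: s0t; rewrite !in_itv /= => /andP[-> /lt_le_trans ->].
have gc : {within `[0, t], continuous g}.
  apply: continuous_subspaceW (_ : {within `[0, 1], continuous g}).
    by apply: subset_itvl; rewrite bnd_simp.
  move=> u; apply: cvgB; first exact: hc.
  by apply: continuous_subspaceT; exact: continuous_horner.
have [u u0t] := MVT_segment t0 gd gc.
rewrite /g P0 subrr subr0 /P hornerD opprD addrA hornerZ hornerXn => gt.
rewrite -subr_le0 -mulrA (mulrC (t ^+ _)) mulrA gt.
rewrite subr0 mulr_le0_ge0//.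
rewrite derivD derivZ derivXn deriv_taylor_poly hornerD hornerZ hornerMn hornerXn.
rewrite opprD addrA subr_le0 /=.
have u01 : u \in `[0, 1].
  by move: u0t; rewrite !in_itv /= => /andP[-> /le_trans ->].
apply: le_trans (IH u u01) _.
rewrite (factS p.+1) natrM -[u ^+ _ *+ _]mulr_natr le_eqVlt.
have n1 : p.+2%:R != 0 :> R by rewrite pnatr_eq0.
have n2 : (p.+1)`!%:R != 0 :> R by rewrite pnatr_eq0 -lt0n fact_gt0.
apply/orP; left; apply/eqP; move: (_%:R) (_%:R) n1 n2 => x y n1 n2.
by field; rewrite n1 n2.
Qed.

Lemma taylor_lipschitz (p : nat) (phi : nat -> R -> R) (K : R) :
  (forall k (t : R), (k < p)%N -> t \in `]0, 1[ -> is_derive t 1 (phi k) (phi k.+1 t)) ->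
  (forall k, (k < p)%N -> {within `[0, 1], continuous (phi k)}) ->
  (forall t : R, t \in `[0, 1] -> `|phi p t - phi p 0| <= K * t) ->
  `|phi 0%N 1 - \sum_(k < p.+1) phi k 0 / k`!%:R| <= K / (p.+1)`!%:R.
Proof.
move=> hd hc hK; have i1 : (1 : R) \in `[0, 1] by rewrite in_itv /= ler01 lexx.
have E (a : nat -> R) : (taylor_poly p.+1 a).[1] = \sum_(k < p.+1) a k / k`!%:R.
  by rewrite horner_poly; apply: eq_bigr => i _; rewrite expr1n mulr1.
rewrite ler_norml; apply/andP; split.
  (* The lower bound is the one-sided estimate applied to the negated family. *)
  have := @taylor_lipschitz_le p (fun k s => - phi k s) K.
  move=> /(_ _ _ _ 1 i1); rewrite E expr1n mulr1.
  under eq_bigr do rewrite mulNr; rewrite sumrN => h.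
  rewrite -lerN2 opprK opprD; apply: h.
  - by move=> *; apply: is_deriveN; exact: hd.
  - by move=> k kp u; apply: cvgN; exact: hc.
  - by move=> t /hK; rewrite ler_norml -opprD lerNl => /andP[].
have := @taylor_lipschitz_le p phi K hd hc _ 1 i1; rewrite E expr1n mulr1; apply.
by move=> t /hK; rewrite ler_norml => /andP[].
Qed.
End Taylor.

(** * Derivatives relative to the unit interval *)

Section RealDerivative.
Variable R : realType.

(** Differentiability relative to [0, 1], hence one-sided at the endpoints: what a derivative within
    a set gives along a segment. *)
Definition derivative01 (g : R -> R) (s l : R) : Prop :=
  forall eps : R, 0 < eps -> exists2 d : R, 0 < d &
    forall t : R, 0 <= t <= 1 -> `|t - s| < d ->
      `|g t - g s - (t - s) * l| <= eps * `|t - s|.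

Lemma derivative01_is_derive (g : R -> R) s l :
  s \in `]0, 1[ -> derivative01 g s l -> is_derive s 1 g l.
Proof.
rewrite in_itv /= => /andP[s0 s1] gs.
have lim : h^-1 *: ((g \o shift s) (h *: (1 : R)) - g s) @[h --> 0^'] --> l.
  apply/cvgrPdist_le => e e0; have [d d0 hd] := gs e e0.
  near=> h.
  have h0 : h != 0 by near: h; exact: nbhs_dnbhs_neq.
  (* The bounds s and 1 - s keep h + s inside [0, 1]. *)
  have hm : `|h| < Num.min d (Num.min s (1 - s)).
    near: h; apply: dnbhs0_lt; rewrite !lt_min d0 s0; lra.
  move: hm; rewrite !lt_min => /and3P[hd' hs h1].
  have := hd (h + s); rewrite addrK => /(_ _ hd') hh.
  have {}hh := hh _.
  rewrite /= [_ *: 1]mulr1 distrC.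
  have -> : h^-1 *: (g (h + s) - g s) - l = h^-1 * (g (h + s) - g s - h * l).
    by rewrite mulrBr mulKf.
  rewrite normrM normfV mulrC ler_pdivrMr ?normr_gt0//.
  apply: hh; move: hs h1; rewrite !ltr_norml; lra.
apply: DeriveDef; first by apply/cvg_ex; exists l.
exact: cvg_lim lim.
Unshelve. all: by end_near. Qed.

Lemma derivative01_continuous (g l : R -> R) :
  (forall s, 0 <= s <= 1 -> derivative01 g s (l s)) -> {within `[0, 1], continuous g}.
Proof.
move=> gl; apply/subspace_continuousP => s /=; rewrite in_itv /= => s01.
apply/cvgrPdist_le => e e0.
(* Accuracy 1 is enough: near s it gives |g t - g s| <= (1 + |l s|) |t - s|. *)
have [d d0 hd] := gl s s01 1 ltr01.
have L0 : 0 < 1 + `|l s| by rewrite ltr_pwDl.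
rewrite near_withinE; near=> t => /=; rewrite in_itv /= => t01.
have : `|t - s| < Num.min d (e / (1 + `|l s|)).
  rewrite distrC; near: t; apply/nbhs_ballP.
  by exists (Num.min d (e / (1 + `|l s|))) => //=; rewrite lt_min d0 divr_gt0.
rewrite lt_min => /andP[td te]; have := hd t t01 td; rewrite mul1r => h.
have -> : g s - g t = - (g t - g s - (t - s) * l s) - (t - s) * l s by ring.
apply: le_trans (ler_normB _ _) _; rewrite normrN normrM.
apply: le_trans (lerD h (lexx _)) _.
rewrite -{1}[`|t - s|]mulr1 -mulrDr.
by rewrite -ler_pdivlMr// ltW.
Unshelve. all: by end_near. Qed.

End RealDerivative.

(** * Multilinear forms on the diagonal and Taylor's bound along segments *)

Section Forms.
Context {R : realType} {E : vectType R}.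
Variable B : 'Hom(E, dual_space E).
Hypothesis hB : spd B.

Lemma BnormZ (a : R) (h : E) : Bnorm B (a *: h) = `|a| * Bnorm B h.
Proof.
rewrite /Bnorm !linearZ /= scale_lfunE /= [_ *: _]mulrA -expr2.
by rewrite sqrtrM ?sqr_ge0// sqrtr_sqr.
Qed.

Lemma BnormB x y : Bnorm B (x - y) = Bnorm B (y - x).
Proof. by rewrite -opprB -scaleN1r BnormZ normrN1 mul1r. Qed.

Lemma Bnorm_ge0 (h : E) : 0 <= Bnorm B h.
Proof. exact: sqrtr_ge0. Qed.

Lemma Bnorm_unit (h : E) : exists2 u, Bnorm B u <= 1 & h = Bnorm B h *: u.
Proof.
have [->|h0] := eqVneq h 0.
  by exists 0; [rewrite -(scale0r 0) BnormZ normr0 mul0r ler01|rewrite scaler0].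
have n0 : 0 < Bnorm B h by rewrite sqrtr_gt0 hB.2.
exists ((Bnorm B h)^-1 *: h).
  by rewrite BnormZ normfV gtr0_norm// mulVf ?gt_eqF.
by rewrite scalerA mulfV ?scale1r ?gt_eqF.
Qed.

Lemma meval_linear k (h : k.-tuple E) a (A A' : mform E k) :
  meval (a *: A + A') h = a * meval A h + meval A' h.
Proof.
elim: k h A A' => [|k IH] h A A' //=.
by rewrite add_lfunE scale_lfunE IH.
Qed.

Lemma mevalB k (A A' : mform E k) h : meval (A - A') h = meval A h - meval A' h.
Proof. by have := meval_linear k h (-1) A' A; rewrite scaleN1r mulN1r addrC [RHS]addrC. Qed.

Lemma mevalZ k a (A : mform E k) h : meval (a *: A) h = a * meval A h.
Proof.
have := meval_linear k h a A 0.
by rewrite -{2}(subrr A) mevalB subrr !addr0.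
Qed.

Lemma mdiagS k (A : mform E k.+1) h :
  mdiag A h = mdiag ((A : 'Hom(E, mform E k)) h) h.
Proof. by rewrite /mdiag /=; congr meval; exact: val_inj. Qed.

Lemma mdiagZ k (A : mform E k) a h : mdiag A (a *: h) = a ^+ k * mdiag A h.
Proof.
elim: k A => [|k IH] A; first by rewrite expr0 mul1r.
by rewrite mdiagS IH mdiagS linearZ /= /mdiag mevalZ exprSr mulrA.
Qed.

Lemma mdiag_le k (A : mform E k) c h :
  (forall u : k.-tuple E, (forall i, Bnorm B (tnth u i) <= 1) -> `|meval A u| <= c) ->
  `|mdiag A h| <= c * Bnorm B h ^+ k.
Proof.
move=> Ac; have [u u1 {1}->] := Bnorm_unit h.
rewrite mdiagZ normrM normrX ger0_norm ?Bnorm_ge0// mulrC.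
rewrite ler_wpM2r ?exprn_ge0 ?Bnorm_ge0//.
by apply: Ac => i; rewrite (tnth_nth 0) /= nth_nseq ltn_ord.
Qed.

Lemma mnorm_le k (A : mform E k) c :
  (mnorm B A <= c%:E)%E ->
  forall u : k.-tuple E, (forall i, Bnorm B (tnth u i) <= 1) -> meval A u <= c.
Proof.
move=> Ac u u1; rewrite -lee_fin; apply: le_trans Ac.
by apply: ereal_sup_ubound; exists u.
Qed.

Lemma lipschitz_diag (S : set E) p (Df : forall k, E -> mform E k) L x y h :
  lipschitz_derivative B S p Df L -> S x -> S y ->
  `|mdiag (Df p x) h - mdiag (Df p y) h| <= L * Bnorm B (x - y) * Bnorm B h ^+ p.
Proof.
move=> hL Sx Sy; rewrite -mevalB.
apply: (mdiag_le p (Df p x - Df p y)) => u u1.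
(* [mnorm] is a supremum without absolute value, so the lower bound comes from exchanging x and
   y. *)
rewrite ler_norml (mnorm_le _ _ _ (hL _ _ Sx Sy) _ u1) andbT.
rewrite lerNl mevalB opprB -mevalB BnormB.
exact: mnorm_le (hL _ _ Sy Sx) _ u1.
Qed.

Lemma segment_derivative (S : set E) k (G : E -> mform E k) (A : mform E k.+1) x h s :
  (forall t : R, 0 <= t <= 1 -> S (x + t *: h)) ->
  is_derivative_within B S G (x + s *: h) A ->
  derivative01 R (fun t => mdiag (G (x + t *: h)) h) s (mdiag A h).
Proof.
move=> hS hG e e0.
have n0 := Bnorm_ge0 h.
have m0 : 0 < Bnorm B h ^+ k.+1 + 1 by rewrite ltr_wpDl// exprn_ge0.
(* The increment contributes one factor |h| and the k arguments contribute |h|^k; adding 1 keeps the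
   quotient defined when h = 0. *)
have [d d0 hd] := hG (e / (Bnorm B h ^+ k.+1 + 1)) (divr_gt0 e0 m0).
exists (d / (Bnorm B h + 1)); first by rewrite divr_gt0// ltr_wpDl.
move=> t t01; rewrite ltr_pdivlMr ?ltr_wpDl// => td.
have E1 : x + t *: h - (x + s *: h) = (t - s) *: h.
  by rewrite opprD addrACA subrr add0r scalerBl.
have /hd := hS t t01; rewrite E1 BnormZ => /(_ _)/mdiag_le.
move=> /(_ h) hh.
rewrite mdiagS -mevalZ -!mevalB.
rewrite linearZ in hh.
apply: le_trans (hh _) _.
  by apply: le_lt_trans td; rewrite ler_wpM2l// lerDl.
have -> : e / (Bnorm B h ^+ k.+1 + 1) * (`|t - s| * Bnorm B h) * Bnorm B h ^+ k
    = e * `|t - s| * (Bnorm B h ^+ k.+1 / (Bnorm B h ^+ k.+1 + 1)).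
  by rewrite exprS; ring.
rewrite ler_piMr ?mulr_ge0//; first exact: ltW.
by rewrite ler_pdivrMr// mul1r lerDl.
Qed.

(** The scalar bound is applied to t |-> D^k f(x + t h)[h]^k with h = y - x, for which K = L
    |h|^(p+1). *)
Lemma taylor_remainder_le (S : set E) p f (Df : forall k, E -> mform E k) L x y :
  (0 < p)%N -> derivatives_on B S p f Df -> lipschitz_derivative B S p Df L ->
  (forall t : R, 0 <= t <= 1 -> S (x + t *: (y - x))) ->
  `|f y - (f x + \sum_(1 <= k < p.+1) (k`!%:R)^-1 * mdiag (Df k x) (y - x))|
    <= L * Bnorm B (y - x) ^+ p.+1 / (p.+1)`!%:R.
Proof.
move=> p0 [Df0 DfS _] hL hS; pose h := y - x.
pose phi k (t : R) := mdiag (Df k (x + t *: h)) h.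
have Sx : S x by have := hS 0; rewrite scale0r addr0 lexx ler01; exact.
have Sy : S y by have := hS 1; rewrite scale1r subrKC lexx ler01; exact.
have hd k (t : R) : (k < p)%N -> 0 <= t <= 1 -> derivative01 R (phi k) t (phi k.+1 t).
  by move=> kp t01; exact: (segment_derivative S _ _ _ _ _ _ hS (DfS _ _ kp (hS t t01))).
have phi0 k : phi k 0 = mdiag (Df k x) h by rewrite /phi scale0r addr0.
have K (t : R) : t \in `[0, 1] -> `|phi p t - phi p 0| <= L * Bnorm B h ^+ p.+1 * t.
  rewrite in_itv /= => t01; rewrite phi0.
  apply: le_trans (lipschitz_diag _ _ _ _ _ _ _ hL (hS t t01) Sx) _.
  rewrite addrAC subrr add0r BnormZ ger0_norm ?(andP t01).1//.
  by rewrite exprS le_eqVlt; apply/orP; left; apply/eqP; ring.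
have := taylor_lipschitz _ p phi _ _ _ K.
have -> : phi 0%N 1 = f y by rewrite /phi scale1r /h subrKC /mdiag /= Df0.
rewrite big_ord_recl phi0 /= fact0 divr1 {1}/mdiag /= Df0// big_add1 /= big_mkord.
under [in X in X -> _]eq_bigr => i _ do rewrite phi0 mulrC.
apply.
  move=> k t kp; rewrite in_itv /= => /andP[t0 t1].
  apply: derivative01_is_derive; first by rewrite in_itv /= t0.
  by apply: hd; rewrite ?(ltW t0) ?(ltW t1).
by move=> k kp; apply: (derivative01_continuous R _ (phi k.+1)) => t; exact: hd.
Qed.

End Forms.

(** * Convexity of the objective and one inexact step *)

Section Composite.
Context {R : realType} {E : vectType R}.
Variables (B : 'Hom(E, dual_space E)) (psi : E -> \bar R) (f : E -> R).
Hypotheses (hB : spd B) (psi_proper : proper_function psi)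
  (psi_convex : convex_epigraph psi)
  (f_convex : convex_function (effective_domain psi) f).
Let dom := effective_domain psi.
Let F y := fine (objective f psi y).

Lemma psi_fineK y : dom y -> (fine (psi y))%:E = psi y.
Proof.
by move=> hy; apply: fineK; rewrite fin_numE psi_proper.1 -ltey.
Qed.

Lemma objectiveE y : dom y -> F y = f y + fine (psi y).
Proof. by move=> hy; rewrite /F /objective -(psi_fineK _ hy). Qed.

Lemma objective_segment x y (t : R) : dom x -> dom y -> 0 <= t <= 1 ->
  dom (x + t *: (y - x)) /\ F (x + t *: (y - x)) <= (1 - t) * F x + t * F y.
Proof.
move=> hx hy /andP[t0 t1].
(* The weight t sits on the first argument of [conv], hence the order b, a. *)
have convE (V : lmodType R) (a b : V) :
    @conv R (convex_lmodType V) (Itv01 t0 t1) b a = a + t *: (b - a).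
  transitivity (t *: b + (1 - t) *: a) => //.
  by rewrite scalerBl scale1r scalerBr addrCA addrC -!addrA [- _ + _]addrC.
have ep z : dom z -> (z, fine (psi z)) \in epigraph psi.
  by move=> hz; rewrite inE /epigraph /= psi_fineK.
have := psi_convex _ _ (Itv01 t0 t1) (ep _ hy) (ep _ hx).
rewrite (convE (E * R^o)%type) inE /epigraph /= => h.
have hz : dom (x + t *: (y - x)) by apply: le_lt_trans h _; rewrite ltry.
split=> //; rewrite !objectiveE//.
have := f_convex (Itv01 t0 t1) y x; rewrite !inE => /(_ hy hx).
rewrite (convE E) convRE /= /unstable.onem.
move: h; rewrite -(psi_fineK _ hz) lee_fin /= /GRing.scale /=; lra.
Qed.

Variables (p : nat) (Df : forall k, E -> mform E k) (L : R).
Hypotheses (hp : (0 < p)%N) (L_ge0 : 0 <= L)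
  (hDf : derivatives_on B dom p f Df) (hL : lipschitz_derivative B dom p Df L).

Let taylor x y : dom x -> dom y ->
  `|f y - (f x + \sum_(1 <= k < p.+1) (k`!%:R)^-1 * mdiag (Df k x) (y - x))|
    <= L * Bnorm B (y - x) ^+ p.+1 / (p.+1)`!%:R.
Proof.
move=> hx hy; apply: (taylor_remainder_le _ hB dom) => // t t01.
by have [] := objective_segment _ _ _ hx hy t01.
Qed.

(** The model at M majorizes F M because p L >= L, and its value at y exceeds F y by at most (p L +
    L) |y - x|^(p+1) / (p+1)!, where (p + 1) / (p+1)! = 1 / p!. *)
Lemma inexact_step_le (delta : R) x y M :
  dom x -> dom y -> inexact_monotone_step B p f Df psi (p%:R * L) delta x M ->
  F M <= F y + L * Bnorm B (y - x) ^+ p.+1 / p`!%:R + delta.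
Proof.
move=> hx hy [hM hstep _].
have fact_gt0R i : 0 < i`!%:R :> R by rewrite ltr0n fact_gt0.
pose Om z := f x + \sum_(1 <= k < p.+1) (k`!%:R)^-1 * mdiag (Df k x) (z - x)
    + p%:R * L * Bnorm B (z - x) ^+ p.+1 / (p.+1)`!%:R + fine (psi z).
have OmE z : dom z -> model B p f Df psi (p%:R * L) x z = (Om z)%:E.
  by move=> hz; rewrite /model -(psi_fineK _ hz).
have OmMy : Om M <= Om y + delta.
  have inf_le : (ereal_inf (range (model B p f Df psi (p%:R * L) x)) <= (Om y)%:E)%E.
    by apply: ereal_inf_lbound; exists y => //; rewrite OmE.
  (* The infimum is finite: -oo would make the model gap +oo, and +oo would contradict the finite
     value at y. *)
  move: hstep inf_le; rewrite OmE//; case: ereal_inf => [m| |] //=.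
  by rewrite !lee_fin; lra.
have FM : F M <= Om M.
  rewrite objectiveE// /Om lerD2r -lerBlDl.
  apply: le_trans (le_trans (ler_norm _) (taylor _ _ hx hM)) _.
  rewrite ler_wpM2r ?invr_ge0 ?ler0n// ler_wpM2r ?exprn_ge0 ?Bnorm_ge0//.
  by rewrite ler_peMl// ler1n.
have Omy : Om y <= F y + L * Bnorm B (y - x) ^+ p.+1 / p`!%:R.
  rewrite objectiveE// /Om.
  have := taylor _ _ hx hy; rewrite distrC => /(le_trans (ler_norm _)).
  have -> : L * Bnorm B (y - x) ^+ p.+1 / p`!%:R =
     (p%:R + 1) * (L * Bnorm B (y - x) ^+ p.+1 / (p.+1)`!%:R).
    rewrite natr1 factS natrM; move: (fact_gt0R p) => /gt_eqF/negbT f0.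
    have : p.+1%:R != 0 :> R by rewrite pnatr_eq0.
    by move: (p.+1%:R) (p`!%:R) f0 => u v u0 v0; field; rewrite u0 v0.
  set T := L * _ / _; have -> : p%:R * L * Bnorm B (y - x) ^+ p.+1 / (p.+1)`!%:R = p%:R * T.
    by rewrite /T !mulrA.
  lra.
lra.
Qed.

(** The step is compared with the point x + s (xs - x), where convexity bounds F and the distance to
    x is s |xs - x|. *)
Lemma inexact_step_contraction (delta D s : R) x xs M :
  dom x -> dom xs -> Bnorm B (x - xs) <= D -> 0 <= s <= 1 ->
  inexact_monotone_step B p f Df psi (p%:R * L) delta x M ->
  F M - F xs <= (1 - s) * (F x - F xs) + s ^+ p.+1 * (L * D ^+ p.+1 / p`!%:R) + delta.
Proof.
move=> hx hxs hD s01 hM; have [hz Fz] := objective_segment _ _ _ hx hxs s01.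
have := inexact_step_le _ _ _ _ hx hz hM.
rewrite [x + _ - x]addrAC subrr add0r (BnormZ _ s) ger0_norm ?(andP s01).1// (BnormB _ xs).
rewrite exprMn.
have h : Bnorm B (x - xs) ^+ p.+1 <= D ^+ p.+1.
  by rewrite lerXn2r ?nnegrE ?(le_trans (Bnorm_ge0 _ _) hD) ?Bnorm_ge0.
have {}h : L * (s ^+ p.+1 * Bnorm B (x - xs) ^+ p.+1) / p`!%:R
    <= s ^+ p.+1 * (L * D ^+ p.+1 / p`!%:R).
  rewrite [leRHS]mulrA ler_wpM2r ?invr_ge0// mulrCA ler_wpM2l//.
    by rewrite exprn_ge0 ?(andP s01).1.
  by rewrite ler_wpM2l.
lra.
Qed.

End Composite.

(** * Transfer of the scalar rate to the iterates of the method *)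

Theorem theorem2 (R : realType) (E : vectType R) (B : 'Hom(E, dual_space E))
  (hB : spd B)
  (p : nat) (hp : (1 <= p)%N)
  (psi : E -> \bar R) (psi_proper : proper_function psi)
  (psi_closed : closed_function B psi)
  (psi_convex : convex_epigraph psi)
  (f : E -> R) (f_convex : convex_function (effective_domain psi) f)
  (Df : forall k, E -> mform E k) (hDf : derivatives_on B (effective_domain psi) p f Df)
  (L : R) (L_ge0 : 0 <= L) (hL : lipschitz_derivative B (effective_domain psi) p Df L)
  (xs : E) (hxs : is_solution f psi xs)
  (c : R) (c_ge0 : 0 <= c) (hc : c < 1 / ((p + 2)%:R * 3 ^+ (p + 1) - 1))
  (delta : nat -> R) (x : nat -> E) (n : nat)
  (hx : monotone_inexact_tensor_method_II B p f Df psi L delta x n)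
  (delta1_ge0 : 0 <= delta 1%N)
  (hdelta : forall k, (2 <= k <= n)%N ->
     delta k = c * (fine (objective f psi (x (k - 2)%N))
                    - fine (objective f psi (x (k - 1)%N))))
  (hD : (level_radius B f psi xs (x 0%N) < +oo)%E) :
  let F y := fine (objective f psi y) in
  let D := fine (level_radius B f psi xs (x 0%N)) in
  let gamma := (p + 2)%:R ^+ (p + 1) / (1 - c * ((p + 2)%:R * 3 ^+ (p + 1) - 1)) in
  let beta := (delta 1%N + c * 2 ^+ (p + 2) * (F (x 0%N) - F xs))
              / (1 - c * ((p + 2)%:R ^+ 2 / (p + 1)%:R - 1)) in
  forall k, (1 <= k <= n)%N ->
    F (x k) - F xs <= gamma * L * D ^+ (p + 1) / (p`!%:R * k%:R ^+ p)
                      + beta / k%:R ^+ (p + 2).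
Proof.
move=> F D gamma beta k kn.
have [dom0 hstep] := hx.
have hdom i : (i <= n)%N -> effective_domain psi (x i).
  by case: i => // i /hstep[_ []].
(* Monotonicity keeps every iterate in the initial level set, so D bounds its distance to xs. *)
have hle i : (i <= n)%N -> (objective f psi (x i) <= objective f psi (x 0%N))%E.
  elim: i => // i IH i_n; have [_ [_ _ /ltW h]] := hstep i i_n.
  exact: le_trans h (IH (ltnW i_n)).
have hDub i : (i <= n)%N -> ((Bnorm B (x i - xs))%:E <= level_radius B f psi xs (x 0%N))%E.
  by move=> i_n; apply: ereal_sup_ubound; exists (x i) => //; exact: hle.
have hDfin : D%:E = level_radius B f psi xs (x 0%N).
  (* The supremum is not -oo because x_0 itself belongs to the level set. *)
  apply: fineK; rewrite fin_real// hD andbT.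
  by apply: lt_le_trans (hDub 0%N (leq0n n)); rewrite ltNyr.
have hDle i : (i <= n)%N -> Bnorm B (x i - xs) <= D.
  by move=> i_n; rewrite -lee_fin hDfin hDub.
have D0 : 0 <= D := le_trans (Bnorm_ge0 B _) (hDle 0%N (leq0n n)).
have C0 : 0 <= L * D ^+ p.+1 / p`!%:R by rewrite divr_ge0// mulr_ge0// exprn_ge0.
have N0 : 0 < p.+2%:R * 3 ^+ p.+1 - 1 :> R.
  rewrite subr_gt0 exprS; have : 1 <= (3 : R) ^+ p by rewrite exprn_ege1//; lra.
  have : 2 <= p.+2%:R :> R by rewrite ler_nat.
  nra.
have d_ge0 i : (i <= n)%N -> 0 <= F (x i) - F xs.
  move=> i_n; have := hxs.2 (x i); rewrite subr_ge0 -lee_fin.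
  have [hi hs] := (hdom i i_n, hxs.1).
  rewrite /F /objective -(psi_fineK _ psi_proper _ hi) -(psi_fineK _ psi_proper _ hs).
  by [].
have := rate_of_recursion R p c (L * D ^+ p.+1 / p`!%:R)
  (fun i => F (x i) - F xs) delta n hp c_ge0.
move: hc; rewrite {1}addn1 {1}addn2 ltr_pdivlMr// => cN /(_ cN C0 delta1_ge0 d_ge0).
rewrite /gamma /beta !addn1 !addn2 => rate.
have := rate _ _ k kn.
have -> : p.+2%:R ^+ p.+1 / (1 - c * (p.+2%:R * 3 ^+ p.+1 - 1)) *
    (L * D ^+ p.+1 / p`!%:R) / k%:R ^+ p =
  p.+2%:R ^+ p.+1 / (1 - c * (p.+2%:R * 3 ^+ p.+1 - 1)) * L * D ^+ p.+1 /
    (p`!%:R * k%:R ^+ p) by rewrite invfM; ring.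
apply.
  (* The optimal value cancels, so differences of F are differences of the gaps. *)
  move=> i i_n; rewrite hdelta// subn2 subn1 /= /F; ring.
move=> i s i_n s01; have [_ hM] := hstep i i_n.
apply: (inexact_step_contraction B psi f hB psi_proper psi_convex f_convex p Df L) => //.
- exact/hdom/ltnW.
- exact: hxs.1.
- exact/hDle/ltnW.
Qed.
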